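(* Let $k$ be a positive integer, let $G_1,G_2$ be disjoint copies of $C_{3k+2}$, and let $f:V(G_1)\to V(G_2)$ be a function. If there exist two vertices $x,y\in V(G_1)$ such that $d_{G_1}(x,y)\equiv 1\pmod 3$ and $d_{G_2}(f(x),f(y))\not\equiv 1\pmod 3$, then $\gamma(C(C_{3k+2},f))<2\gamma(C_{3k+2})$.
   Context: For disjoint copies $G_1,G_2$ of a graph $G$ and a function $f:V(G_1)\to V(G_2)$, the functigraph $C(G,f)$ has vertex set $V(G_1)\cup V(G_2)$ and edge set $E(G_1)\cup E(G_2)\cup\{uv : u\in V(G_1), v\in V(G_2), v=f(u)\}$. $\gamma$ denotes domination number. $d_{G_i}(x,y)$ denotes the distance between $x$ and $y$ in the cycle $G_i$. *)

(* Defs.v *)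
From mathcomp Require Import all_boot.

Set Implicit Arguments.
Unset Strict Implicit.
Unset Printing Implicit Defensive.

(* A finite simple graph is given by its adjacency relation, a symmetric
   irreflexive [e : rel T] on a finite type [T]. *)

(* Least length of an [e]-path from [x] to [y].  A shortest path has length
   less than [#|T|], so the search is bounded; the value is [#|T|] when [x]
   and [y] are not connected. *)
Definition gdist (T : finType) (e : rel T) (x y : T) : nat :=
  find (fun n => [exists p : n.-tuple T, path e x p && (last x p == y)])
       (iota 0 #|T|).

Definition dominating (T : finType) (e : rel T) (D : {set T}) : bool :=
  [forall v, (v \in D) || [exists u in D, e u v]].

Definition domination_number (T : finType) (e : rel T) : nat :=
  #|[arg min_(D < [set: T] | dominating e D) #|D|]|.

(* The cycle graph C_n; it is a simple graph (an n-cycle) for [2 < n]. *)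
Definition cycle_graph (n : nat) : rel 'I_n :=
  fun i j => (i.+1 %% n == j) || (j.+1 %% n == i).

(* The left summand of [T + T] is the copy G_1 and the right one is G_2. *)
Definition functigraph (T : finType) (e : rel T) (f : T -> T) : rel (T + T) :=
  fun a b =>
    match a, b with
    | inl u, inl v => e u v
    | inr u, inr v => e u v
    | inl u, inr v => v == f u
    | inr v, inl u => v == f u
    end.

Lemma dominatingT (T : finType) (e : rel T) : dominating e [set: T].
Proof. by apply/forallP => v; rewrite in_setT. Qed.

Lemma cycle_graph_sym n : symmetric (@cycle_graph n).
Proof. by move=> i j; rewrite /cycle_graph orbC. Qed.

Lemma cycle_graph_irrefl n : 2 < n -> irreflexive (@cycle_graph n).
Proof.
move=> n_gt2 i; rewrite /cycle_graph orbb; apply/negbTE/negP.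
have := ltn_ord i; rewrite leq_eqVlt => /orP[/eqP iE|lt_i].
  by rewrite iE modnn => /eqP i0; move: n_gt2; rewrite -iE -i0.
by rewrite modn_small // => /eqP/esym/n_Sn.
Qed.

Lemma functigraph_sym (T : finType) (e : rel T) (f : T -> T) :
  symmetric e -> symmetric (functigraph e f).
Proof. by move=> e_sym [u|u] [v|v] //=; apply: e_sym. Qed.

Lemma functigraph_irrefl (T : finType) (e : rel T) (f : T -> T) :
  irreflexive e -> irreflexive (functigraph e f).
Proof. by move=> e_irr [u|u] /=; apply: e_irr. Qed.

(* Main.v *)
(** A dominating set of [C_(3k+2)] has at least [k+1] vertices, each of them
    dominating three; so it suffices to dominate the functigraph by [2k+1].
    Call [r u v] the length of the arc from [u] to [v] in the positive direction.
    As [3k+2 - r] is [1] modulo [3] exactly when [r] is, the hypotheses say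
    [r x y = 1] and [r (f x) (f y) <> 1] modulo [3].  Hence [x] and [y] cut
    [G_1] into two arcs whose interiors have lengths divisible by [3], so that
    [k] vertices dominate all of [G_1] but [x] and [y].  On the other side [f x]
    and [f y], in some order, bound an arc of length [0] modulo [3], so both lie
    in a dominating set [{u, u+3, ..., u+3k}] of [G_2]; they then dominate [x]
    and [y]. *)

Require Import Defs.
From mathcomp Require Import all_boot zify.

Set Implicit Arguments.
Unset Strict Implicit.
Unset Printing Implicit Defensive.

(** The bound [d < #|T|] puts [d] inside the searched range, so [find] succeeds at some index at
    most [d]; that index is itself the length of a path, hence at least [d]. *)
Lemma gdistE (T : finType) (e : rel T) (x y : T) (d : nat) :
  d < #|T| ->
  (exists p, [/\ path e x p, last x p = y & size p = d]) ->
  (forall p, path e x p -> last x p = y -> d <= size p) ->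
  gdist e x y = d.
Proof.
move=> d_lt [p [e_p p_y p_d]] d_min; rewrite /gdist.
set P := (fun m => _).
have Pd : P d.
  apply/existsP; exists (tcast p_d (in_tuple p)).
  by rewrite val_tcast /= e_p p_y eqxx.
have le_d : find P (iota 0 #|T|) <= d.
  rewrite leqNgt; apply/negP => /(before_find 0).
  by rewrite nth_iota // add0n Pd.
have : has P (iota 0 #|T|).
  by apply/hasP; exists d; rewrite // mem_iota.
move=> /(nth_find 0); rewrite nth_iota ?add0n; last exact: leq_ltn_trans d_lt.
case/existsP=> q /andP[e_q /eqP q_y].
by apply/eqP; rewrite eqn_leq le_d -{1}(size_tuple q) d_min.
Qed.

Lemma domination_number_le (T : finType) (e : rel T) (D : {set T}) :
  dominating e D -> domination_number e <= #|D|.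
Proof.
by move=> domD; rewrite /domination_number; case: arg_minnP => [|E _ ->];
  first exact: dominatingT.
Qed.

(** Adding [n] first keeps the truncated subtraction exact. *)
Definition arc_length (n : nat) (u v : 'I_n) : nat := (v + n - u) %% n.

Lemma arc_lengthE (n : nat) (u v : 'I_n) :
  arc_length u v = if u <= v then v - u else v + n - u.
Proof.
rewrite /arc_length; have := ltn_ord u; have := ltn_ord v => v_lt u_lt.
case: leqP => uv; last by rewrite modn_small //; lia.
by rewrite -addnBAC // modnDr modn_small //; lia.
Qed.

Lemma arc_length_lt (n : nat) (u v : 'I_n) : arc_length u v < n.
Proof. by rewrite ltn_mod; have := ltn_ord u; lia. Qed.

Lemma val_iter_ordS (n : nat) (u : 'I_n) (i : nat) :
  iter i (@ordS n) u = (u + i) %% n :> nat.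
Proof.
elim: i => [|i IHi] /=; first by rewrite addn0 modn_small.
by rewrite IHi -addn1 modnDml addn1 addnS.
Qed.

Lemma iter_arc_length (n : nat) (u v : 'I_n) :
  iter (arc_length u v) (@ordS n) u = v.
Proof.
apply: val_inj; rewrite /= val_iter_ordS modnDmr.
by rewrite subnKC ?modnDr ?modn_small //; have := ltn_ord u; lia.
Qed.

(** Removing [%%] from adjacency leaves four linear cases that [lia] can handle. *)
Lemma cycle_graphP (n : nat) (u v : 'I_n) :
  reflect [\/ v = u.+1 :> nat, u = v.+1 :> nat,
              v = 0 :> nat /\ u = n.-1 :> nat |
              u = 0 :> nat /\ v = n.-1 :> nat]
    (cycle_graph u v).
Proof.
have succ_modE (w : 'I_n) : w.+1 %% n = if w.+1 == n then 0 else w.+1.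
  case: eqP => [->|]; first by rewrite modnn.
  by move=> neq; rewrite modn_small //; have := ltn_ord w; lia.
rewrite /cycle_graph !succ_modE; have := ltn_ord u; have := ltn_ord v.
move=> v_lt u_lt; apply: (iffP idP).
  case/orP; case: ifP => /eqP uE /eqP vE;
    [apply: Or43 | apply: Or41 | apply: Or44 | apply: Or42]; lia.
by case=> [||[]|[]] *; apply/orP; [left|right|left|right]; case: ifP; lia.
Qed.

Lemma gdist_cycle_graph (n : nat) (x y : 'I_n) :
  gdist (@cycle_graph n) x y = minn (arc_length x y) (n - arc_length x y).
Proof.
apply: gdistE.
- by rewrite card_ord; have := arc_length_lt x y; lia.
- have [m dE] := ubnP (minn (arc_length x y) (n - arc_length x y)).
  elim: m x dE => // m IHm x dE.
  have [->|xy] := eqVneq x y.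
    by exists [::]; split; rewrite // arc_lengthE leqnn subnn min0n.
  (* Take for [z] the neighbour of [x] on a shorter arc to [y]: the successor or the predecessor of
     [x], with wrap-around at [n.-1] and at [0]. *)
  have [z xz zE] : exists2 z, cycle_graph x z &
      minn (arc_length x y) (n - arc_length x y)
      = (minn (arc_length z y) (n - arc_length z y)).+1.
    have {}xy : x <> y :> nat by move/val_inj/eqP; rewrite (negPf xy).
    have := ltn_ord x; have := ltn_ord y => y_lt x_lt.
    have [near|far] := leqP (arc_length x y) (n - arc_length x y).
      have [lt|ge] := ltnP x.+1 n.
        exists (Ordinal lt); first by apply/cycle_graphP; apply: Or41.
        by move: near; rewrite !arc_lengthE /=; do ![case: ifP => ?]; lia.
      have lt : 0 < n by lia.
      exists (Ordinal lt).
        by apply/cycle_graphP; apply: Or43; split=> //=; lia.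
      by move: near; rewrite !arc_lengthE /=; do ![case: ifP => ?]; lia.
    have [lt|ge] := ltnP 0 x.
      have lt' : x.-1 < n by lia.
      exists (Ordinal lt'); first by apply/cycle_graphP; apply: Or42 => /=; lia.
      by move: far; rewrite !arc_lengthE /=; do ![case: ifP => ?]; lia.
    have lt : n.-1 < n by lia.
    exists (Ordinal lt).
      by apply/cycle_graphP; apply: Or44; split=> //=; lia.
    by move: far; rewrite !arc_lengthE /=; do ![case: ifP => ?]; lia.
  have [|p [e_p p_y p_size]] := IHm z; first by lia.
  by exists (z :: p); split; rewrite /= ?xz // p_size zE.
(* Lower bound: moving along one edge changes the minimum of the two arc lengths by at most one. *)
- move=> p; elim: p x => [|z p IHp] x /=.
    by move=> _ ->; rewrite arc_lengthE leqnn; lia.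
  move=> /andP[xz e_p] p_y; have := IHp z e_p p_y; move: (size p) => m.
  move: xz => /cycle_graphP; rewrite !arc_lengthE.
  have := ltn_ord x; have := ltn_ord y; have := ltn_ord z.
  by move=> z_lt y_lt x_lt; case=> [||[]|[]]; do ![case: ifP => ?]; lia.
Qed.

Lemma gdist_cycle_graph_mod3 (k : nat) (x y : 'I_(3 * k + 2)) :
  gdist (@cycle_graph (3 * k + 2)) x y = 1 %[mod 3] <->
  arc_length x y = 1 %[mod 3].
Proof. by rewrite gdist_cycle_graph; have := arc_length_lt x y; lia. Qed.

(** The closed neighbourhoods [N u] of a dominating set cover the cycle, and each has at most three
    vertices. *)
Lemma domination_number_cycle_graph_ge (n : nat) :
  n <= 3 * domination_number (@cycle_graph n).
Proof.
rewrite /domination_number; case: arg_minnP => [|D domD _].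
  exact: dominatingT.
pose N u := [set u; ordS u; @ord_pred n u].
have card_N u : #|N u| <= 3.
  by rewrite /N setUC !cardsU1 cards1; do 2![case: (_ \notin _)].
have : [set: 'I_n] \subset \bigcup_(u in D) N u.
  apply/subsetP=> v _; move/forallP: domD => /(_ v) /orP[vD|].
    by apply/bigcupP; exists v; rewrite // !inE eqxx.
  case/existsP=> u /andP[uD /orP uv]; apply/bigcupP; exists u => //.
  rewrite !inE; case: uv => /eqP E.
    by rewrite (_ : v = ordS u) ?eqxx ?orbT //; apply: val_inj.
  have -> : u = ordS v by apply: val_inj.
  by rewrite ordSK eqxx !orbT.
move=> /subset_leq_card; rewrite cardsT card_ord => /leq_trans; apply.
rewrite mulnC -sum_nat_const.
apply: (@leq_trans (\sum_(u in D) #|N u|)); last exact: leq_sum.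
elim/big_rec2: _ => [|u a B _ IH]; first by rewrite cards0.
by rewrite (leq_trans (leq_card_setU _ _)) // leq_add2l.
Qed.

Lemma dominated_by_near_iter (n : nat) (D : {set 'I_n}) (u : 'I_n)
  (c i : nat) :
  iter c (@ordS n) u \in D -> [|| c == i, c.+1 == i | c == i.+1] ->
  (iter i (@ordS n) u \in D) ||
    [exists w in D, cycle_graph w (iter i (@ordS n) u)].
Proof.
move=> cD /or3P[/eqP <-|/eqP ciE|/eqP ciE]; first by rewrite cD.
  apply/orP; right; apply/existsP; exists (iter c (@ordS n) u).
  by rewrite cD -ciE /cycle_graph eqxx.
apply/orP; right; apply/existsP; exists (iter c (@ordS n) u).
by rewrite cD ciE /cycle_graph eqxx orbT.
Qed.

Lemma dominating_cycle_graph_but_two (k : nat) (x y : 'I_(3 * k + 2)) :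
  arc_length x y = 1 %[mod 3] ->
  exists2 D : {set 'I_(3 * k + 2)}, #|D| <= k &
    forall v, v != x -> v != y ->
      (v \in D) || [exists u in D, cycle_graph u v].
Proof.
move=> xy1; set a := arc_length x y in xy1.
(* Offsets from [x] of the centres of consecutive triples: they tile [1..a-1], then skip [a], the
   offset of [y], and tile [a+1..3k+1]. *)
pose c t := if 3 * t < a.-1 then 3 * t + 2 else 3 * t + 3.
exists [set iter (c t) (@ordS _) x | t : 'I_k].
  by rewrite (leq_trans (leq_imset_card _ _)) ?card_ord.
move=> v; rewrite -(iter_arc_length x v); set i := arc_length x v.
have i_lt : i < 3 * k + 2 := arc_length_lt x v.
have [->|i_neq0 _] := eqVneq i 0; first by rewrite eqxx.
have [->|i_neqa _] := eqVneq i a; first by rewrite iter_arc_length eqxx.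
have [lt_ia|le_ai] := ltnP i a.
  have t_lt : i.-1 %/ 3 < k by have := arc_length_lt x y; rewrite -/a; lia.
  apply: (@dominated_by_near_iter _ _ _ (c (i.-1 %/ 3))).
    by apply/imsetP; exists (Ordinal t_lt).
  by rewrite /c; case: ifP; lia.
have t_lt : i.-2 %/ 3 < k by lia.
apply: (@dominated_by_near_iter _ _ _ (c (i.-2 %/ 3))).
  by apply/imsetP; exists (Ordinal t_lt).
by rewrite /c; case: ifP; lia.
Qed.

Lemma dominating_cycle_graph_through (k : nat) (u v : 'I_(3 * k + 2)) :
  3 %| arc_length u v ->
  exists D : {set 'I_(3 * k + 2)},
    [/\ #|D| <= k.+1, u \in D, v \in D & dominating (@cycle_graph _) D].
Proof.
move=> uv0; exists [set iter (3 * t) (@ordS _) u | t : 'I_k.+1]; split.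
- by rewrite (leq_trans (leq_imset_card _ _)) ?card_ord.
- by apply/imsetP; exists ord0.
- have t_lt : arc_length u v %/ 3 < k.+1 by have := arc_length_lt u v; lia.
  apply/imsetP; exists (Ordinal t_lt) => //=.
  have -> : 3 * (arc_length u v %/ 3) = arc_length u v by lia.
  by rewrite iter_arc_length.
- apply/forallP=> w; rewrite -(iter_arc_length u w).
  have t_lt : (arc_length u w).+1 %/ 3 < k.+1.
    by have := arc_length_lt u w; lia.
  (* The centre is the multiple of 3 nearest to the offset of [w]; as offsets are at most [3k+1], it
     never exceeds [3k]. *)
  apply: (@dominated_by_near_iter _ _ _ (3 * ((arc_length u w).+1 %/ 3))).
    by apply/imsetP; exists (Ordinal t_lt).
  by lia.
Qed.

(** A vertex of the first copy whose image lies in [D2] is dominated by that image, so [D1] has to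
    take care only of the others. *)
Lemma dominating_functigraph (T : finType) (e : rel T) (f : T -> T)
  (D1 D2 : {set T}) :
  (forall v, f v \notin D2 -> (v \in D1) || [exists u in D1, e u v]) ->
  dominating e D2 ->
  dominating (functigraph e f) ((inl @: D1) :|: (inr @: D2)).
Proof.
have inl_inj : injective (@inl T T) by move=> ? ? [].
have inr_inj : injective (@inr T T) by move=> ? ? [].
move=> dom1 /forallP dom2; apply/forallP=> -[v|v].
  have [fvD|/dom1 /orP[vD|/existsP[u /andP[uD uv]]]] := boolP (f v \in D2).
  - apply/orP; right; apply/existsP; exists (inr (f v)).
    by rewrite /= eqxx in_setU (mem_imset _ _ inr_inj) fvD orbT.
  - by rewrite in_setU (mem_imset _ _ inl_inj) vD.
  - apply/orP; right; apply/existsP; exists (inl u).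
    by rewrite /= uv in_setU (mem_imset _ _ inl_inj) uD.
have /orP[vD|/existsP[u /andP[uD uv]]] := dom2 v.
  by rewrite in_setU (mem_imset _ _ inr_inj) vD orbT.
apply/orP; right; apply/existsP; exists (inr u).
by rewrite /= uv in_setU (mem_imset _ _ inr_inj) uD orbT.
Qed.

Theorem theorem4p6 (k : nat) (k_gt0 : 0 < k)
  (f : 'I_(3 * k + 2) -> 'I_(3 * k + 2)) :
  (exists x y : 'I_(3 * k + 2),
     gdist (@cycle_graph (3 * k + 2)) x y = 1 %[mod 3] /\
     gdist (@cycle_graph (3 * k + 2)) (f x) (f y) <> 1 %[mod 3]) ->
  domination_number (functigraph (@cycle_graph (3 * k + 2)) f)
    < 2 * domination_number (@cycle_graph (3 * k + 2)).
Proof.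
move=> [x [y [/gdist_cycle_graph_mod3 xy1]]].
rewrite gdist_cycle_graph_mod3 => fxy.
have [D1 cardD1 domD1] := dominating_cycle_graph_but_two xy1.
have [D2 [cardD2 fxD fyD domD2]] : exists D : {set 'I_(3 * k + 2)},
    [/\ #|D| <= k.+1, f x \in D, f y \in D & dominating (@cycle_graph _) D].
  have [fxy0|fxyN0] := boolP (3 %| arc_length (f x) (f y)).
    exact: dominating_cycle_graph_through.
  (* Here the arc from [f x] to [f y] has length 2 modulo 3, so the complementary arc of the [3k+2]
     cycle has length 0 modulo 3. *)
  have fyx0 : 3 %| arc_length (f y) (f x).
    have := ltn_ord (f x); have := ltn_ord (f y) => fy_lt fx_lt.
    by move: fxy fxyN0; rewrite !arc_lengthE; do ![case: ifP => ?]; lia.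
  by have [D [? ? ? ?]] := dominating_cycle_graph_through fyx0; exists D.
have dom : dominating (functigraph (@cycle_graph (3 * k + 2)) f)
    ((inl @: D1) :|: (inr @: D2)).
  apply: dominating_functigraph => // v fvD; apply: domD1.
    by apply: contraNneq fvD => ->.
  by apply: contraNneq fvD => ->.
apply: leq_ltn_trans (domination_number_le dom) _.
apply: leq_ltn_trans (leq_card_setU _ _) _.
apply: leq_ltn_trans (leq_add (leq_imset_card _ _) (leq_imset_card _ _)) _.
apply: leq_ltn_trans (leq_add cardD1 cardD2) _.
(* Three times the domination number is at least [3k+2], so the number is at least [k+1], and its
   double exceeds [k + (k+1)]. *)
by have := domination_number_cycle_graph_ge (3 * k + 2); lia.
Qed.
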